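(* Let $\Omega\subseteq\mathbb{R}^n$ be an open convex set and $g:\Omega\to\mathbb{R}$ an $\alpha$-self-concordant function, $\alpha>0$. Take $x_*\in\Omega$ with $g''(x_* )$ invertible, let $\|\cdot\|_{x_*}$ be the norm $\|u\|_{x_*}=\sqrt{\alpha^{-1}\langle g''(x_* )u,u\rangle}$, let $W_r(x_* )=\{x\in\mathbb{R}^n:\|x-x_*\|_{x_*}<r\}$, and let $\kappa:=\sup\{u>0: W_u(x_* )\subset\Omega\}$. Suppose that $g'(x_* )=0$. Take $0\le\vartheta<1$ and $0\le\omega_2<\omega_1$ such that $\omega_1\vartheta+\omega_2<1$. Let $a=\omega_1(1+\vartheta)$, $b=1-\omega_1\vartheta-\omega_2$ and $$\sigma:=\min\left\{\kappa,\ \frac{a+4b-\sqrt{(a+4b)^2-8b^2}}{4b}\right\}.$$ Then any inexact Newton-like method for solving $g'(x)=0$ with initial point $x_0\in W_\sigma(x_* )\setminus\{x_*\}$, $$x_{k+1}=x_k+S_k,\qquad B(x_k)S_k=-g'(x_k)+r_k,\qquad k=0,1,\ldots,$$ where $B(x_k)$ is an invertible approximation of $g''(x_k)$ satisfying $$\|B(x_k)^{-1}g''(x_k)\|_{x_*}\le\omega_1,\qquad\|B(x_k)^{-1}g''(x_k)-I\|_{x_*}\le\omega_2,$$ and the residual $r_k$ satisfies $\|P_kr_k\|_{x_*}\le\theta_k\|P_kg'(x_k)\|_{x_*}$ for some sequence $\{\theta_k\}$ of non-negative numbers and some sequence $\{P_k\}$ of invertible matrices satisfying $\theta_k\,\mathrm{cond}(P_kg''(x_k))\le\vartheta$,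 is well defined, its sequence $\{x_k\}$ is contained in $W_\sigma(x_* )$, converges to $x_*$, and $$\|x_{k+1}-x_*\|_{x_*}\le\left[\omega_1(1+\vartheta)\frac{\|x_0-x_*\|_{x_*}}{2(1-\|x_0-x_*\|_{x_*})^2-1}+\omega_1\vartheta+\omega_2\right]\|x_k-x_*\|_{x_*},\qquad\forall\,k=0,1,\ldots.$$
   Context: A function $g:\Omega\to\mathbb{R}$ on a convex set $\Omega\subset\mathbb{R}^n$ is $\alpha$-self-concordant with parameter $\alpha>0$ if $g$ is three times continuously differentiable in $\Omega$, convex on $\Omega$, and $$|g'''(x)[h,h,h]|\le2\alpha^{-1/2}(g''(x)[h,h])^{3/2},\qquad\forall\,x\in\Omega,\ \forall\,h\in\mathbb{R}^n.$$ $\langle\cdot,\cdot\rangle$ is the Euclidean inner product; $g'(x)\in\mathbb{R}^n$ is identified with the gradient and $g''(x)$ with the Hessian matrix. Operator norms of linear maps on $\mathbb{R}^n$ are those induced by $\|\cdot\|_{x_*}$, and $\mathrm{cond}(T):=\|T\|_{x_*}\|T^{-1}\|_{x_*}$ for invertible $T$; $I$ is the identity. ''Well defined'' means that each iterate $x_k$ lies in $\Omega$ and $g''(x_k)$ is invertible, so that the conditions defining the next step make sense. *)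

(* Defs.v *)
From HB Require Import structures.
From mathcomp Require Import all_boot all_order all_algebra.
From mathcomp Require Import all_classical all_reals all_analysis.

Set Implicit Arguments.
Unset Strict Implicit.
Unset Printing Implicit Defensive.

Import Order.TTheory GRing.Theory Num.Theory.
Import numFieldNormedType.Exports.

Local Open Scope classical_set_scope.
Local Open Scope ring_scope.

(* A function on an open set Omega of R^n is encoded as a total function on
   'cV[R]_n. Every notion below is evaluated at points of Omega only, and as
   derivatives are local, the values outside the open set Omega are
   irrelevant. *)
Section Differentiation.
Context {R : realType} {n : nat}.
Implicit Types (f g : 'cV[R]_n -> R) (x h : 'cV[R]_n).

(* f is k + 1 times continuously differentiable iff it is Frechet
   differentiable and its derivative is k times continuously differentiable;
   in finite dimension, the latter can be tested on each direction v. *)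
Fixpoint Ck_on (Omega : set 'cV[R]_n) (k : nat) f : Prop :=
  match k with
  | 0 => forall x, Omega x -> {for x, continuous f}
  | k'.+1 => (forall x, Omega x -> differentiable f x) /\
             forall v : 'cV[R]_n, Ck_on Omega k' ('D_v f)
  end.

Definition grad g x : 'cV[R]_n := \col_i 'D_(delta_mx i 0) g x.

Definition hess g x : 'M[R]_n :=
  \matrix_(i, j) 'D_(delta_mx j 0) ('D_(delta_mx i 0) g) x.

(* g''(x)[h, h] and g'''(x)[h, h, h] *)
Definition D2 g x h : R := 'D_h ('D_h g) x.
Definition D3 g x h : R := 'D_h ('D_h ('D_h g)) x.

Definition self_concordant (Omega : set 'cV[R]_n) (alpha : R) g : Prop :=
  [/\ 0 < alpha,
      Ck_on Omega 3 g,
      @convex_function R 'cV[R]_n Omega g &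
      forall x h, Omega x ->
        `|D3 g x h| <= 2 * alpha `^ (- (1 / 2)) * (D2 g x h) `^ (3 / 2)].

End Differentiation.

Section Norms.
Context {R : realType} {n : nat}.
Implicit Types (N : 'cV[R]_n -> R) (T : 'M[R]_n) (u v : 'cV[R]_n).

Definition inner u v : R := \sum_i u i 0 * v i 0.

Definition local_norm (alpha : R) (g : 'cV[R]_n -> R) (xs : 'cV[R]_n) u : R :=
  Num.sqrt (alpha^-1 * inner (hess g xs *m u) u).

Definition opnorm N T : R := sup [set N (T *m u) | u in [set u | N u <= 1]].

(* Meaningful for invertible T only: invmx T is T when T is singular. *)
Definition cond N T : R := opnorm N T * opnorm N (invmx T).

(* The radius is an extended real because the supremum kappa below is +oo
   when Omega is the whole space. *)
Definition W N (xs : 'cV[R]_n) (r : \bar R) : set 'cV[R]_n :=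
  [set x | ((N (x - xs))%:E < r)%E].

Definition kappa N (Omega : set 'cV[R]_n) (xs : 'cV[R]_n) : \bar R :=
  ereal_sup [set u%:E | u in [set u : R | 0 < u /\ W N xs u%:E `<=` Omega]].

End Norms.

Record inexact_newton_like_step {R : realType} {n : nat}
    (g : 'cV[R]_n -> R) (N : 'cV[R]_n -> R) (omega1 omega2 vartheta : R)
    (B : 'cV[R]_n -> 'M[R]_n) (P : nat -> 'M[R]_n) (theta : nat -> R)
    (x S r : nat -> 'cV[R]_n) (k : nat) : Prop := InexactNewtonLikeStep {
  step_update : x k.+1 = x k + S k ;
  step_equation : B (x k) *m S k = - grad g (x k) + r k ;
  step_B_unit : B (x k) \in unitmx ;
  step_B_bound : opnorm N (invmx (B (x k)) *m hess g (x k)) <= omega1 ;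
  step_B_approx :
    opnorm N (invmx (B (x k)) *m hess g (x k) - 1%:M) <= omega2 ;
  step_theta_ge0 : 0 <= theta k ;
  step_P_unit : P k \in unitmx ;
  step_residual : N (P k *m r k) <= theta k * N (P k *m grad g (x k)) ;
  step_forcing : theta k * cond N (P k *m hess g (x k)) <= vartheta
}.

(* Main.v *)
Require Import Defs.
From HB Require Import structures.
From mathcomp Require Import all_boot all_order all_algebra.
From mathcomp Require Import all_classical all_reals all_analysis.
From mathcomp Require Import ring lra.

Import Order.TTheory GRing.Theory Num.Theory.
Import numFieldNormedType.Exports.

Local Open Scope classical_set_scope.
Local Open Scope ring_scope.

(* Write e = x - xs, t = |e|_{xs}, and consider g along the segment from xs to
   x. Self-concordance bounds g''' on the diagonal only; Banach's theorem on
   symmetric trilinear forms extends the bound to g'''[u, u, v], which is what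
   controls the derivatives along the segment of g''[h, h] (u = h, v = e) and of
   g'[h] (u = e, v = h). Comparison with the scalar majorant whose second
   derivative is 2 / (1 - s)^3 then gives g''(x) >= (1 - t)^2 g''(xs) and
   |g''(xs)^-1 (g''(x) e - g'(x))|_{xs} <= (t / (1 - t))^2, whence
   |e - g''(x)^-1 g'(x)|_{xs} <= t^2 / (1 - t)^4 <= t^2 / (2 (1 - t)^2 - 1).
   With J = B^-1 g'', a step of the method maps e to
   (I - J) e + J (e - g''^-1 g') + J g''^-1 r, and the forcing condition bounds
   the last term by omega1 vartheta |g''^-1 g'|. The resulting contraction factor
   is below 1 exactly when t is below the smaller root of
   2 b t^2 - (a + 4 b) t + b. *)

(** * Cubic forms in two variables *)

(** Triple-angle formulas: x + i y is the cube root of p + i q at a third of its angle. As [acos]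
    only reaches angles with nonnegative sine, complex conjugation reduces the case q < 0 to the
    other one. *)
Lemma cube_root_unit (R : realType) (p q : R) : p ^+ 2 + q ^+ 2 = 1 ->
  exists x y : R, [/\ x ^+ 2 + y ^+ 2 = 1,
    p = x ^+ 3 - 3 * x * y ^+ 2 & q = 3 * x ^+ 2 * y - y ^+ 3].
Proof.
wlog q0 : q / 0 <= q => [wl|] pq.
  have [/wl/(_ pq)//|q0] := leP 0 q.
  have [||x [y [xy hp hq]]] := wl (- q); [by rewrite oppr_ge0 ltW|by rewrite sqrrN|].
  by exists x, (- y); rewrite sqrrN; split => //; lra.
have p1 : -1 <= p <= 1 by apply/andP; split; nra.
have sinq : sin (acos p) = q.
  by rewrite sin_acos// -pq [p ^+ 2 + _]addrC addrK sqrtr_sqr ger0_norm.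
set t := acos p / 3.
have tE : acos p = t + (t + t) by rewrite /t; field.
have cs := cos2Dsin2 t.
exists (cos t), (sin t); split => //.
- rewrite -{1}(acosK p1) tE cosD cosD sinD; ring.
- rewrite -{1}sinq tE sinD cosD sinD; ring.
Qed.

Section cubic_on_circle.
Variables (R : realType) (a b c d M : R).
Let f (x y : R) :=
  a * x ^+ 3 + 3 * b * x ^+ 2 * y + 3 * c * x * y ^+ 2 + d * y ^+ 3.
Hypothesis fM : forall x y, x ^+ 2 + y ^+ 2 = 1 -> f x y ^+ 2 <= M.

Let conj_sum (r p q s t : R) : r ^+ 2 = 3 ->
  (p + r * q) * (s + r * t) + (p - r * q) * (s - r * t) = 2 * p * s + 6 * q * t.
Proof.
move=> r2; transitivity (2 * p * s + 2 * r ^+ 2 * q * t); first by ring.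
by rewrite r2; ring.
Qed.

(** The argument is (x, y) rotated by a third of a turn, in a sense given by the sign of [r].
    Splitting the value as u + r v makes the odd powers of [r] cancel when both rotations are added
    with conjugate weights. *)
Let fconj (r x y : R) : r ^+ 2 = 3 ->
  f (- (x + r * y) / 2) ((- y + r * x) / 2) =
  (- a * (x ^+ 3 + 9 * x * y ^+ 2) + 3 * b * (5 * x ^+ 2 * y - 3 * y ^+ 3)
    - 3 * c * (3 * x ^+ 3 - 5 * x * y ^+ 2) - d * (9 * x ^+ 2 * y + y ^+ 3)) / 8
  + r * ((- a * 3 * (x ^+ 2 * y + y ^+ 3) + 3 * b * (x ^+ 3 + x * y ^+ 2)
    - 3 * c * (x ^+ 2 * y + y ^+ 3) + 3 * d * (x ^+ 3 + x * y ^+ 2)) / 8).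
Proof.
move=> r2.
have r3 : r ^+ 3 = 3 * r by rewrite exprS r2 mulrC.
rewrite /f.
transitivity
 ((- a * (x ^+ 3 + 3 * x ^+ 2 * y * r + 3 * x * y ^+ 2 * r ^+ 2 + y ^+ 3 * r ^+ 3)
   + 3 * b * (r * (x ^+ 3 - 2 * x * y ^+ 2) + r ^+ 2 * (2 * x ^+ 2 * y - y ^+ 3)
              - x ^+ 2 * y + r ^+ 3 * x * y ^+ 2)
   - 3 * c * (x * y ^+ 2 + r ^+ 2 * (x ^+ 3 - 2 * x * y ^+ 2)
              + r * (y ^+ 3 - 2 * x ^+ 2 * y) + r ^+ 3 * x ^+ 2 * y)
   + d * (r ^+ 3 * x ^+ 3 - 3 * r ^+ 2 * x ^+ 2 * y + 3 * r * x * y ^+ 2 - y ^+ 3)) / 8).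
  by field.
by rewrite r3 r2; field.
Qed.

(* With z = (x, y) on the unit circle, the three nodes are the cube roots of z ^ 3;
   the weights are the values there of the Fejer kernel (sin (3 t) / (3 sin t)) ^ 2. *)
Let quadrature (r x y : R) : r ^+ 2 = 3 ->
  ((3 * x ^+ 2 - y ^+ 2) / 3) ^+ 2 * f x y
  + (2 / 3 * y * (y + r * x)) ^+ 2 * f (- (x + r * y) / 2) ((- y + r * x) / 2)
  + (2 / 3 * y * (y - r * x)) ^+ 2 * f (- (x - r * y) / 2) ((- y - r * x) / 2)
  = (x ^+ 2 + y ^+ 2) ^+ 2 *
    (a * (x ^+ 3 - 3 * x * y ^+ 2) + b * (3 * x ^+ 2 * y - y ^+ 3)).
Proof.
move=> r2; rewrite (fconj r x y r2).
have r2' : (- r) ^+ 2 = 3 by rewrite sqrrN.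
have := fconj (- r) x y r2'; rewrite !mulNr => ->.
have w r' : r' ^+ 2 = 3 -> (2 / 3 * y * (y + r' * x)) ^+ 2 =
    4 / 9 * y ^+ 2 * (y ^+ 2 + 3 * x ^+ 2) + r' * (8 / 9 * x * y ^+ 3).
  move=> r'2; transitivity
    (4 / 9 * y ^+ 2 * (y ^+ 2 + r' ^+ 2 * x ^+ 2) + r' * (8 / 9 * x * y ^+ 3)).
    by field.
  by rewrite r'2.
have -> := w _ r2; have := w (- r) r2'; rewrite !mulNr => ->.
rewrite -addrA conj_sum// /f.
by field.
Qed.

(** For the symmetric trilinear form T of [f], [a] and [b] are T(e1, e1, e1) and T(e1, e1, e2), so
    T(e1, e1, .) is bounded by the diagonal values. The quadrature at the cube roots of (a + i b) /
    s writes [s] as a convex combination of values of [f], each at most sqrt M. *)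
Lemma cubic_on_circle : a ^+ 2 + b ^+ 2 <= M.
Proof.
have M0 : 0 <= M.
  by apply: le_trans (fM 1 0 _); rewrite ?sqr_ge0// expr1n expr0n addr0.
have [ab0|ab0] := eqVneq (a ^+ 2 + b ^+ 2) 0; first by rewrite ab0.
have abp : 0 < a ^+ 2 + b ^+ 2 by rewrite lt_def ab0 addr_ge0 ?sqr_ge0.
set s := Num.sqrt (a ^+ 2 + b ^+ 2).
have s0 : 0 < s by rewrite sqrtr_gt0.
have s2 : s ^+ 2 = a ^+ 2 + b ^+ 2 by rewrite sqr_sqrtr// ltW.
have [|x [y [xy pE qE]]] := cube_root_unit R (a / s) (b / s).
  by rewrite !expr_div_n -mulrDl -s2 divff// lt0r_neq0// exprn_gt0.
set r := Num.sqrt (3 : R).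
have r2 : r ^+ 2 = 3 by rewrite sqr_sqrtr.
have := quadrature r x y r2; rewrite xy expr1n mul1r -pE -qE.
have -> : a * (a / s) + b * (b / s) = s.
  by rewrite !mulrA -mulrDl -!expr2 -s2 expr2 mulfK// gt_eqF.
set w0 := (X in X * f x y); set w1 := (2 / 3 * y * (y + r * x)) ^+ 2.
set w2 := (2 / 3 * y * (y - r * x)) ^+ 2.
have w012 : w0 + w1 + w2 = 1.
  transitivity ((x ^+ 2 + y ^+ 2) ^+ 2 + (r ^+ 2 - 3) * (8 / 9 * x ^+ 2 * y ^+ 2)).
    by rewrite /w0 /w1 /w2; field.
  by rewrite r2 xy; ring.
have fs (u v : R) : u ^+ 2 + v ^+ 2 = 1 -> f u v <= Num.sqrt M.
  move=> /fM uv; rewrite (le_trans (ler_norm _))// -sqrtr_sqr.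
  by rewrite ler_wsqrtr.
have r2xy : (- (x + r * y) / 2) ^+ 2 + ((- y + r * x) / 2) ^+ 2 = 1.
  transitivity ((1 + r ^+ 2) / 4 * (x ^+ 2 + y ^+ 2)); first by field.
  by rewrite r2 xy; field.
have r2xy' : (- (x - r * y) / 2) ^+ 2 + ((- y - r * x) / 2) ^+ 2 = 1.
  transitivity ((1 + r ^+ 2) / 4 * (x ^+ 2 + y ^+ 2)); first by field.
  by rewrite r2 xy; field.
move=> sE; rewrite -s2 -(sqr_sqrtr M0) ler_sqr ?nnegrE ?sqrtr_ge0//.
rewrite -[leRHS]mul1r -w012 -sE (mulrDl (w0 + w1)) (mulrDl w0).
by apply: lerD; first apply: lerD; rewrite ler_wpM2l ?sqr_ge0// fs.
Qed.

End cubic_on_circle.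

(** Banach's inequality in the plane, with [b] in the role of T(u, u, v) and [A], [B], [C] the Gram
    entries of u and v. A definite form becomes Euclidean in orthonormal coordinates, where the
    bound on the circle applies; the general case follows by adding [e] to [A] and [C] and letting
    [e] tend to 0. *)
Lemma cubic_le_quad (R : realType) (a b c d A B C M : R) :
  0 <= M -> (forall x y, 0 <= A * x ^+ 2 + 2 * B * x * y + C * y ^+ 2) ->
  (forall x y,
    (a * x ^+ 3 + 3 * b * x ^+ 2 * y + 3 * c * x * y ^+ 2 + d * y ^+ 3) ^+ 2 <=
    M * (A * x ^+ 2 + 2 * B * x * y + C * y ^+ 2) ^+ 3) ->
  b ^+ 2 <= M * (A ^+ 2 * C).
Proof.
move=> M0 q0 fq.
have A0 : 0 <= A by have := q0 1 0; rewrite expr0n expr1n /= !mulr0 mulr1 !addr0.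
have C0 : 0 <= C by have := q0 0 1; rewrite expr0n expr1n /= !mulr0 mul0r mulr1 !add0r.
have D0 : B ^+ 2 <= A * C.
  have [A00|An0] := eqVneq A 0.
    (* For A = 0 the form takes the value - B^2 at this point, so [B] vanishes. *)
    rewrite A00 mul0r; have := q0 (- (C + 1) / 2) B.
    by rewrite A00 => h; have := sqr_ge0 B; nra.
  have := q0 (- B) A => h.
  have Ap : 0 < A by rewrite lt_def An0.
  by rewrite -subr_ge0 -(pmulr_rge0 _ Ap); nra.
suff pert e : 0 < e -> b ^+ 2 <= M * ((A + e) ^+ 2 * (C + e)).
  apply/ler_addgt0Pr => e e0.
  (* For h <= 1 the higher powers of [h] are at most [h], so the perturbation raises the bound by at
     most [h * K]; the last 1 makes [K] positive. *)
  set K := M * (A ^+ 2 + 2 * A * C + 2 * A + C + 1) + 1.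
  have K0 : 0 < K by rewrite ltr_wpDl// mulr_ge0//; nra.
  pose h := Num.min 1 (e / K).
  have h0 : 0 < h by rewrite lt_min ltr01 divr_gt0.
  have h1 : h <= 1 by rewrite ge_min lexx.
  have he : h * K <= e by rewrite -ler_pdivlMr// ge_min lexx orbT.
  apply: (le_trans (pert h h0)); rewrite -lerBlDl; apply: le_trans he.
  rewrite -subr_ge0.
  have -> : h * K - (M * ((A + h) ^+ 2 * (C + h)) - M * (A ^+ 2 * C)) =
    h * (1 + M * ((1 - h) * (2 * A + C + 1 + h))) by rewrite /K; ring.
  rewrite mulr_ge0 ?(ltW h0)// addr_ge0// mulr_ge0// mulr_ge0 ?subr_ge0//.
  by rewrite !addr_ge0 ?mulr_ge0 ?(ltW h0).
move=> e0; set A' := A + e; set C' := C + e.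
have A'0 : 0 < A' by rewrite ltr_wpDl.
have C'0 : 0 < C' by rewrite ltr_wpDl.
set D := A' * C' - B ^+ 2.
have Dp : 0 < D by rewrite /D /A' /C'; nra.
have fq' x y :
    (a * x ^+ 3 + 3 * b * x ^+ 2 * y + 3 * c * x * y ^+ 2 + d * y ^+ 3) ^+ 2 <=
    M * (A' * x ^+ 2 + 2 * B * x * y + C' * y ^+ 2) ^+ 3.
  apply: le_trans (fq x y) _; rewrite ler_wpM2l//.
  have -> : A' * x ^+ 2 + 2 * B * x * y + C' * y ^+ 2 =
    A * x ^+ 2 + 2 * B * x * y + C * y ^+ 2 + e * (x ^+ 2 + y ^+ 2).
    by rewrite /A' /C'; ring.
  have exy : 0 <= e * (x ^+ 2 + y ^+ 2).
    by rewrite mulr_ge0 ?(ltW e0) ?addr_ge0 ?sqr_ge0.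
  have qxy := q0 x y.
  by rewrite lerXn2r ?nnegrE ?lerDl// addr_ge0.
(* Coordinates orthonormal for the perturbed quadratic form. *)
set s := Num.sqrt A'; set k := Num.sqrt D.
have s0 : 0 < s by rewrite sqrtr_gt0.
have k0 : 0 < k by rewrite sqrtr_gt0.
have s2 : s ^+ 2 = A' by rewrite sqr_sqrtr// ltW.
have k2 : k ^+ 2 = D by rewrite sqr_sqrtr// ltW.
have sn0 : s != 0 by rewrite gt_eqF.
have kn0 : k != 0 by rewrite gt_eqF.
have C'E : C' = (k ^+ 2 + B ^+ 2) / s ^+ 2.
  by rewrite k2 /D subrK s2 mulrC mulKf// gt_eqF.
pose a' := a / s ^+ 3.
pose b' := (b * s ^+ 2 - B * a) / (k * s ^+ 3).
pose c' := (c * s ^+ 4 - 2 * B * b * s ^+ 2 + B ^+ 2 * a) / (k ^+ 2 * s ^+ 3).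
pose d' := (d * s ^+ 6 - 3 * B * c * s ^+ 4 + 3 * B ^+ 2 * b * s ^+ 2 - B ^+ 3 * a)
  / (k ^+ 3 * s ^+ 3).
have ab : a' ^+ 2 + b' ^+ 2 <= M.
  apply: (cubic_on_circle R a' b' c' d') => x y xy.
  apply: le_trans (le_trans (fq' (x / s - B * y / (k * s)) (s * y / k)) _).
    by rewrite le_eqVlt; apply/orP; left; apply/eqP; congr (_ ^+ 2);
      rewrite /a' /b' /c' /d'; field; rewrite sn0 kn0.
  rewrite (_ : A' * _ + _ + _ = 1) ?expr1n ?mulr1//.
  by rewrite -[RHS]xy C'E -s2; field; rewrite sn0 kn0.
(* In the orthonormal coordinates the two original vectors are (s, 0) and (B / s, k / s), and the
   latter has squared length [C']. Trilinearity gives [b], and Cauchy-Schwarz then concludes. *)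
have -> : b = s * B * a' + s * k * b'.
  by rewrite /a' /b'; field; rewrite sn0 kn0.
have -> : A' ^+ 2 * C' = s ^+ 2 * (k ^+ 2 + B ^+ 2).
  by rewrite C'E -s2; field; rewrite sn0.
have CS : (s * B * a' + s * k * b') ^+ 2 <=
    s ^+ 2 * (k ^+ 2 + B ^+ 2) * (a' ^+ 2 + b' ^+ 2).
  rewrite -subr_ge0 (_ : _ - _ = (s * (B * b' - k * a')) ^+ 2) ?sqr_ge0//.
  by ring.
apply: le_trans CS _; rewrite [leRHS]mulrC ler_wpM2l//.
by rewrite mulr_ge0 ?addr_ge0 ?sqr_ge0.
Qed.

(** * Directional derivatives *)

Section line.
Variables (R : realType) (V : normedModType R).
Implicit Types (f : V -> R) (a v : V).

Lemma is_derive_line f a v (s : R) : derivable f (a + s *: v) v ->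
  is_derive s 1 (fun t : R => f (a + t *: v)) ('D_v f (a + s *: v)).
Proof.
move=> df.
have E : (fun h : R => h^-1 *: (((fun t : R => f (a + t *: v)) \o shift s)
           (h *: (1 : R)) - f (a + s *: v))) =
         (fun h : R => h^-1 *: ((f \o shift (a + s *: v)) (h *: v)
           - f (a + s *: v))).
  apply/funext => h /=; congr (_ *: (f _ - _)).
  by rewrite [h *: _]mulr1 scalerDl addrCA.
by apply: DeriveDef; rewrite /derivable /derive E.
Qed.

End line.

Lemma mvt0 (R : realType) (F dF : R -> R) (b : R) : 0 <= b ->
  (forall s, 0 <= s <= b -> is_derive s 1 F (dF s)) ->
  exists2 s, 0 <= s <= b & F b - F 0 = b * dF s.
Proof.
move=> b0 hF; have [x xb||c] := @MVT_segment R F dF 0 b b0.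
- by apply: hF; move: xb; rewrite in_itv/= => /andP[/ltW -> /ltW ->].
- by apply: derivable_within_continuous => s; rewrite in_itv/= => /hF[].
by rewrite in_itv/= subr0 mulrC; exists c.
Qed.

Lemma derive1_le0_le (R : realType) (F dF : R -> R) (b : R) : 0 <= b ->
  (forall s, 0 <= s <= b -> is_derive s 1 F (dF s)) ->
  (forall s, 0 <= s <= b -> dF s <= 0) -> F b <= F 0.
Proof.
move=> b0 hF hdF; have [c cb E] := mvt0 R F dF b b0 hF.
by rewrite -subr_le0 E mulr_ge0_le0 ?hdF.
Qed.


(** * Second differences: symmetry of second derivatives, and their sign for convex functions *)

Section Ck.
Variables (R : realType) (n : nat) (Omega : set 'cV[R]_n).
Hypothesis oO : open Omega.
Implicit Types (f : 'cV[R]_n -> R) (x u v : 'cV[R]_n).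

Lemma Ck_on_pred k f : Ck_on Omega k.+1 f -> Ck_on Omega k f.
Proof.
elim: k f => [|k ih] f [df Df] /=.
  by move=> x Ox; apply: differentiable_continuous; apply: df.
by split => // v; apply: ih.
Qed.

Lemma nbhs_plane x u v (A : set 'cV[R]_n) : nbhs x A -> exists2 d : R, 0 < d &
  forall s t, `|s| <= d -> `|t| <= d -> A (x + s *: u + t *: v).
Proof.
move=> /nbhs_ballP[e /= e0 xeA].
have D0 : 0 < `|u| + `|v| + 1 by rewrite ltr_wpDl ?addr_ge0.
exists (e / (`|u| + `|v| + 1) / 2); first by rewrite !divr_gt0.
move=> s t sd td; apply: xeA; rewrite -ball_normE /= -addrA opprD addNKr.
rewrite normrN (le_lt_trans (ler_normD _ _))// !normrZ.
set d := e / _ in sd td.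
have d0 : 0 < d by rewrite divr_gt0.
have -> : e = d * (`|u| + `|v| + 1) by rewrite /d divfK// gt_eqF.
have := normr_ge0 u; have := normr_ge0 v => v0 u0.
have := ler_wpM2r u0 sd; have := ler_wpM2r v0 td; nra.
Qed.

(** The mean value theorem is used twice: in direction [v] for the increment of [f] over [h *: u],
    then in direction [u] for ['D_v f]. *)
Lemma second_difference f x u v (h : R) : 0 <= h ->
  (forall y, Omega y -> derivable f y v) ->
  (forall y, Omega y -> derivable ('D_v f) y u) ->
  (forall s t, 0 <= s <= h -> 0 <= t <= h -> Omega (x + s *: u + t *: v)) ->
  exists s t, [/\ 0 <= s <= h, 0 <= t <= h &
    f (x + h *: u + h *: v) - f (x + h *: v) - (f (x + h *: u) - f x) =
    h ^+ 2 * 'D_u ('D_v f) (x + s *: u + t *: v)].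
Proof.
move=> h0 fv fuv Oh.
have h0h : 0 <= h <= h by rewrite h0 lexx.
have z0h : 0 <= (0 : R) <= h by rewrite h0 lexx.
have Oline0 t : 0 <= t <= h -> Omega (x + t *: v).
  by move=> th; have := Oh 0 t z0h th; rewrite scale0r addr0.
have phi t : 0 <= t <= h -> is_derive t 1
    ((fun t : R => f (x + h *: u + t *: v)) - (fun t : R => f (x + t *: v)))
    ('D_v f (x + h *: u + t *: v) - 'D_v f (x + t *: v)).
  move=> th; apply: is_deriveB; apply: is_derive_line; apply: fv; first exact: Oh.
  exact: Oline0.
have [t th] := mvt0 _ _ _ h h0 phi.
rewrite !fctE !scale0r !addr0 => E.
have psi s : 0 <= s <= h -> is_derive s 1
    (fun s : R => 'D_v f (x + t *: v + s *: u))
    ('D_u ('D_v f) (x + t *: v + s *: u)).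
  by move=> sh; apply: is_derive_line; apply: fuv; rewrite addrAC; apply: Oh.
have [s sh] := mvt0 _ _ _ h h0 psi.
rewrite scale0r addr0 => E'.
exists s, t; split; [exact: sh|exact: th|].
by rewrite E (addrAC x (h *: u)) E' (addrAC x (s *: u)) mulrA expr2.
Qed.

(* The second difference is d^2 times either mixed derivative at nearby points. *)
Lemma schwarz f x u v : Ck_on Omega 2 f -> Omega x ->
  'D_u ('D_v f) x = 'D_v ('D_u f) x.
Proof.
move=> [df Df] Ox.
have fd y w : Omega y -> derivable f y w by move=> /df; exact: diff_derivable.
have fdd y w w' : Omega y -> derivable ('D_w f) y w'.
  by move=> Oy; apply: diff_derivable; have [+ _] := Df w; apply.
have cont w w' : {for x, continuous ('D_w' ('D_w f))}.
  by have [_ +] := Df w; apply.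
apply/eqP; rewrite -subr_eq0 -normr_le0; apply/ler_addgt0Pr => e e0; rewrite add0r.
have e20 : 0 < e / 2 by rewrite divr_gt0.
have nb w w' : nbhs x [set y | `|'D_w' ('D_w f) x - 'D_w' ('D_w f) y| < e / 2].
  exact: cvgr_dist_lt (cont w w') _ e20.
have [d d0 Hd] := nbhs_plane x u v _ (filterI (open_nbhs_nbhs (conj oO Ox))
  (filterI (nb u v) (nb v u))).
have Ad s t : 0 <= s <= d -> 0 <= t <= d -> _ :=
  fun sd td => Hd s t ltac:(by rewrite ger0_norm; case/andP: sd)
                      ltac:(by rewrite ger0_norm; case/andP: td).
have [|||s [t [sd td E]]] := second_difference f x u v d (ltW d0).
- by move=> y; apply: fd.
- by move=> y; apply: fdd.
- by move=> s t sd td; have [] := Ad s t sd td.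
have [|||t' [s' [td' sd' E']]] := second_difference f x v u d (ltW d0).
- by move=> y; apply: fd.
- by move=> y; apply: fdd.
- by move=> t' s' td' sd'; rewrite addrAC; have [] := Ad s' t' sd' td'.
have [_ [_ /ltW h1]] := Ad s t sd td.
have [_ [/ltW h2 _]] := Ad s' t' sd' td'.
have : d ^+ 2 != 0 by rewrite expf_neq0// gt_eqF.
move=> dn0.
have EE : 'D_u ('D_v f) (x + s *: u + t *: v) =
    'D_v ('D_u f) (x + t' *: v + s' *: u).
  apply: (mulfI dn0); apply: etrans (esym E) _; apply: etrans _ E'.
  have swap (a b c e' : R) : a - b - (c - e') = a - c - (b - e') by ring.
  by rewrite (addrAC x (d *: v)); exact: swap.
have tri (a b c : R) : a - b = (a - c) - (b - c) by ring.
rewrite (tri _ _ ('D_u ('D_v f) (x + s *: u + t *: v))) {2}EE (addrAC x (t' *: v)).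
rewrite (splitr e); exact: le_trans (ler_normB _ _) (lerD h1 h2).
Qed.

(** A negative second derivative stays negative near [x] by continuity. The second difference based
    at [x - d *: h], hence centred at [x], is then negative, against convexity at the midpoint. *)
Lemma convex_D2_ge0 f x h : Ck_on Omega 2 f ->
  @convex_function R 'cV[R]_n Omega f -> Omega x -> 0 <= D2 f x h.
Proof.
move=> [df Df] cf Ox; rewrite leNgt; apply/negP => neg.
have cont : {for x, continuous ('D_h ('D_h f))} by have [_ +] := Df h; apply.
have nb : nbhs x [set y | 'D_h ('D_h f) y < 0].
  exact: cvgr_lt cont _ neg.
have [d d0 Hd] := nbhs_plane x h h _ (filterI (open_nbhs_nbhs (conj oO Ox)) nb).
have Ad s t : 0 <= s <= d -> 0 <= t <= d -> Omega (x - d *: h + s *: h + t *: h) /\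
    D2 f (x - d *: h + s *: h + t *: h) h < 0.
  move=> sd td.
  have -> : x - d *: h + s *: h + t *: h = x + s *: h + (t - d) *: h.
    by rewrite scalerBl [in RHS]addrA (addrAC x) [LHS]addrAC.
  apply: Hd.
    by rewrite ger0_norm; case/andP: sd.
  case/andP: td => t0 td.
  by rewrite ler_norml lerBrDr addNr t0 lerBlDr ler_wpDl// ltW.
have [|||s [t [sd td]]] := second_difference f (x - d *: h) h h d (ltW d0).
- by move=> y /df; exact: diff_derivable.
- by move=> y Oy; apply: diff_derivable; have [+ _] := Df h; apply.
- by move=> s t sd td; have [] := Ad s t sd td.
rewrite subrK; have [_] := Ad s t sd td; rewrite /D2 => {}neg E.
have dd : 0 <= d <= d by rewrite lexx ltW.
have d00 : 0 <= (0 : R) <= d by rewrite lexx ltW.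
have Om : Omega (x - d *: h).
  by have [+ _] := Ad 0 0 d00 d00; rewrite scale0r !addr0.
have Op : Omega (x + d *: h).
  by have [+ _] := Ad d d dd dd; rewrite subrK.
have : f (2^-1 *: (x - d *: h) + (1 - 2^-1) *: (x + d *: h)) <=
    2^-1 * f (x - d *: h) + (1 - 2^-1) * f (x + d *: h).
  have h0 : 0 <= 2^-1 :> R by [].
  have h1 : 2^-1 <= 1 :> R by rewrite invf_le1// ler1n.
  have := cf (Itv01 h0 h1) _ _ (mem_set Om) (mem_set Op).
  exact.
have -> : 2^-1 *: (x - d *: h) + (1 - 2^-1) *: (x + d *: h) = x.
  have -> : 1 - 2^-1 = 2^-1 :> R by field.
  rewrite -scalerDr addrACA. rewrite addNr addr0 scalerDr -scalerDl.
  by rewrite (_ : 2^-1 + 2^-1 = 1 :> R) ?scale1r//; field.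
have dneg : d ^+ 2 * 'D_h ('D_h f) (x - d *: h + s *: h + t *: h) < 0.
  by rewrite pmulr_rlt0// exprn_gt0.
rewrite -E in dneg; move: dneg.
by move: (f x) (f (x - d *: h)) (f (x + d *: h)) => a b c; lra.
Qed.

End Ck.

(** * Symmetric forms and mixed derivatives of self-concordant functions *)

Section symmetric_forms.
Variables (R : realType) (V : lmodType R).
Variables (T : V -> V -> V -> R) (Q : V -> V -> R).
Hypothesis T_linear : forall c u v w z, T (c *: u + v) w z = c * T u w z + T v w z.
Hypothesis T12 : forall u v w, T u v w = T v u w.
Hypothesis T23 : forall u v w, T u v w = T u w v.
Hypothesis Q_linear : forall c u v w, Q (c *: u + v) w = c * Q u w + Q v w.
Hypothesis Q_sym : forall u v, Q u v = Q v u.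
Hypothesis Q_ge0 : forall u, 0 <= Q u u.

Let Q2 x y u v : Q (x *: u + y *: v) (x *: u + y *: v) =
  Q u u * x ^+ 2 + 2 * Q u v * x * y + Q v v * y ^+ 2.
Proof.
have Q0 w : Q 0 w = 0 by have := Q_linear (-1) w w w; rewrite scaleN1r addNr; lra.
have Qr c a b w : Q w (c *: a + b) = c * Q w a + Q w b.
  by rewrite Q_sym Q_linear !(Q_sym w).
have Qz c a w : Q (c *: a) w = c * Q a w.
  by rewrite -[c *: a]addr0 Q_linear Q0 addr0.
by rewrite Q_linear Qz !Qr !(Q_sym _ (y *: v)) !Qz (Q_sym v u); ring.
Qed.

Let T3 x y u v :
  T (x *: u + y *: v) (x *: u + y *: v) (x *: u + y *: v) =
  T u u u * x ^+ 3 + 3 * T u u v * x ^+ 2 * y + 3 * T u v v * x * y ^+ 2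
  + T v v v * y ^+ 3.
Proof.
have T0 w z : T 0 w z = 0.
  by have := T_linear (-1) w w w z; rewrite scaleN1r addNr; lra.
have Tl a b w z : T (x *: a + y *: b) w z = x * T a w z + y * T b w z.
  rewrite T_linear; congr (_ + _).
  by rewrite -[y *: b]addr0 T_linear T0 addr0.
have Tm a b w z : T w (x *: a + y *: b) z = x * T w a z + y * T w b z.
  by rewrite T12 Tl !(T12 w).
have Tr a b w z : T w z (x *: a + y *: b) = x * T w z a + y * T w z b.
  by rewrite T23 Tm !(T23 w z).
rewrite Tl !Tm !Tr (T12 v u u) (T23 u v u) (T12 v u v) (T23 v v u) (T12 v u v).
by ring.
Qed.

(* A special case of Banach's theorem on symmetric multilinear forms. *)
Lemma cubic_form_le M u v : 0 <= M ->
  (forall h, T h h h ^+ 2 <= M * Q h h ^+ 3) ->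
  T u u v ^+ 2 <= M * (Q u u ^+ 2 * Q v v).
Proof.
move=> M0 TM.
apply: (cubic_le_quad R (T u u u) (T u u v) (T u v v) (T v v v) _ (Q u v)) => //.
- by move=> x y; rewrite -Q2.
- by move=> x y; rewrite -Q2 -T3.
Qed.

(** The form is nonnegative at [Q v v *: u - Q u v *: v]. If [Q v v] vanishes, another combination
    is taken, at which the form equals [- Q u v ^+ 2]. *)
Lemma cauchy_schwarz_form u v : Q u v ^+ 2 <= Q u u * Q v v.
Proof.
have q x y := Q_ge0 (x *: u + y *: v).
have A0 := Q_ge0 u; have C0 := Q_ge0 v.
have [C00|Cn0] := eqVneq (Q v v) 0.
  have := q (Q u v) (- (Q u u + 1) / 2); rewrite Q2 C00 mulr0 mul0r addr0 => h.
  by have := sqr_ge0 (Q u v); nra.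
have Cp : 0 < Q v v by rewrite lt_def Cn0.
have := q (Q v v) (- Q u v); rewrite Q2 => h.
rewrite -subr_ge0 -(pmulr_rge0 _ Cp).
suff -> : Q v v * (Q u u * Q v v - Q u v ^+ 2) = Q u u * Q v v ^+ 2 +
  2 * Q u v * Q v v * - Q u v + Q v v * (- Q u v) ^+ 2 by [].
by ring.
Qed.

End symmetric_forms.

Section derivative_forms.
Variables (R : realType) (n : nat) (Omega : set 'cV[R]_n).
Variables (g : 'cV[R]_n -> R).
Hypothesis oO : open Omega.
Implicit Types (x u v w z : 'cV[R]_n).

Lemma derive_linear (f : 'cV[R]_n -> R) x (c : R) u v : differentiable f x ->
  'D_(c *: u + v) f x = c * 'D_u f x + 'D_v f x.
Proof. by move=> fx; rewrite !deriveE// linearP. Qed.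

Lemma inner_gradE (f : 'cV[R]_n -> R) x u : differentiable f x ->
  inner (grad f x) u = 'D_u f x.
Proof.
move=> gx; rewrite /inner deriveE//.
rewrite [in RHS](_ : u = \sum_i u i 0 *: delta_mx i 0); last first.
  by rewrite {1}[u]matrix_sum_delta; apply: eq_bigr => i _; rewrite big_ord1.
rewrite linear_sum; apply: eq_bigr => i _.
by rewrite !mxE linearZ/= deriveE// mulrC.
Qed.

Section at_point.
Variable x : 'cV[R]_n.
Hypotheses (g2 : Ck_on Omega 2 g) (Ox : Omega x).

(** A derivative is linear in its outermost direction only, so [v] is expanded first, the two
    derivatives are exchanged, and then [u] is expanded. *)
Lemma inner_hessE u v : inner (hess g x *m u) v = 'D_v ('D_u g) x.
Proof.
have [dg Dg] := g2.
have Ddiff w : differentiable ('D_w g) x by have [+ _] := Dg w; apply.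
rewrite -(inner_gradE ('D_u g) x v (Ddiff u)) /inner.
apply: eq_bigr => i _; congr (_ * _).
rewrite !mxE (schwarz R n Omega oO g x _ _ g2 Ox).
rewrite -(inner_gradE _ x u (Ddiff _)) /inner; apply: eq_bigr => j _.
by rewrite !mxE mulrC.
Qed.

Lemma hess_linear c u v w : inner (hess g x *m (c *: u + v)) w =
  c * inner (hess g x *m u) w + inner (hess g x *m v) w.
Proof.
rewrite /inner mulmxDr -scalemxAr mulr_sumr -big_split/=; apply: eq_bigr => i _.
by rewrite !mxE; ring.
Qed.

Lemma hess_sym u v : inner (hess g x *m u) v = inner (hess g x *m v) u.
Proof. by rewrite !inner_hessE (schwarz R n Omega oO g x _ _ g2 Ox). Qed.

End at_point.

Variable x : 'cV[R]_n.
Hypotheses (g3 : Ck_on Omega 3 g) (Ox : Omega x).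

Lemma D3_linear c u v w z : 'D_(c *: u + v) ('D_w ('D_z g)) x =
  c * 'D_u ('D_w ('D_z g)) x + 'D_v ('D_w ('D_z g)) x.
Proof.
apply: derive_linear; have [_ +] := g3 => /(_ z)[_ /(_ w)[+ _]]; exact.
Qed.

Lemma D3_swap12 u v w : 'D_u ('D_v ('D_w g)) x = 'D_v ('D_u ('D_w g)) x.
Proof. by apply: (schwarz R n Omega oO) => //; have [_ +] := g3; apply. Qed.

(** The symmetry of second derivatives holds on a neighbourhood of [x], so it may be
    differentiated. *)
Lemma D3_swap23 u v w : 'D_u ('D_v ('D_w g)) x = 'D_u ('D_w ('D_v g)) x.
Proof.
apply: near_eq_derive; near=> y; apply: (schwarz R n Omega oO).
  exact: Ck_on_pred.
by near: y; exact: open_nbhs_nbhs.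
Unshelve. all: by end_near. Qed.

End derivative_forms.

(** * Self-concordance, from the diagonal to mixed directions *)

Section self_concordance.
Variables (R : realType) (n : nat) (Omega : set 'cV[R]_n) (alpha : R).
Variables (g : 'cV[R]_n -> R).
Hypotheses (oO : open Omega) (sc : self_concordant Omega alpha g).

Lemma sc_D2_ge0 x h : Omega x -> 0 <= D2 g x h.
Proof.
have [_ g3 cg _] := sc; apply: convex_D2_ge0 => //; exact: Ck_on_pred.
Qed.

(** Squaring removes the absolute value and the real powers, which gives the polynomial hypothesis
    of [cubic_form_le]. *)
Lemma sc_D3_sqr_le x h : Omega x -> D3 g x h ^+ 2 <= 4 / alpha * D2 g x h ^+ 3.
Proof.
move=> Ox; have [a0 _ _ /(_ x h Ox) D3le] := sc.
have q0 := sc_D2_ge0 x h Ox.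
have -> : 4 / alpha * D2 g x h ^+ 3 =
    (2 * alpha `^ (- (1 / 2)) * D2 g x h `^ (3 / 2)) ^+ 2.
  have E1 : (alpha `^ (- (1 / 2))) ^+ 2 = alpha^-1.
    by rewrite powRN div1r powR12_sqrt ?(ltW a0)// exprVn sqr_sqrtr// ltW.
  have E2 : (D2 g x h `^ (3 / 2)) ^+ 2 = D2 g x h ^+ 3.
    rewrite -[LHS]powR_mulrn ?powR_ge0// -powRrM divfK ?pnatr_eq0//.
    by rewrite powR_mulrn.
  by rewrite !exprMn E1 E2; ring.
by rewrite -real_normK ?num_real// lerXn2r ?nnegrE// (le_trans _ D3le).
Qed.

(** [cubic_form_le] for the third derivative and the Hessian form at [x]: the constant 4 / alpha
    carries over unchanged from the diagonal. *)
Lemma sc_mixed x u v : Omega x ->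
  ('D_u ('D_u ('D_v g)) x) ^+ 2 <= 4 / alpha * (D2 g x u ^+ 2 * D2 g x v).
Proof.
move=> Ox; have [a0 g3 _ _] := sc.
have g2 := Ck_on_pred R n Omega 2 g g3.
have QE w : D2 g x w = inner (hess g x *m w) w.
  by rewrite (inner_hessE R n Omega g oO).
rewrite !QE.
apply: (cubic_form_le R _ (fun u v w => 'D_u ('D_v ('D_w g)) x)
  (fun u v => inner (hess g x *m u) v)).
- by move=> *; apply: (D3_linear R n Omega).
- by move=> *; apply: (D3_swap12 R n Omega).
- by move=> *; apply: (D3_swap23 R n Omega).
- by move=> *; apply: hess_linear.
- by move=> *; apply: (hess_sym R n Omega).
- by move=> w; rewrite -QE sc_D2_ge0.
- by rewrite divr_ge0// ltW.
- by move=> h; rewrite -QE; apply: sc_D3_sqr_le.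
Qed.

End self_concordance.

(** * Differential inequalities *)

Section differential_inequalities.
Variables (R : realType) (t b : R).
Hypotheses (t0 : 0 <= t) (b0 : 0 <= b) (tb1 : t * b < 1).
Let q (s : R) := 1 - t * s.
Let p (s : R) := (q s)^-1.

Let q_gt0 s : 0 <= s <= b -> 0 < q s.
Proof.
move=> /andP[s0 sb]; rewrite subr_gt0; apply: le_lt_trans tb1.
by rewrite ler_wpM2l.
Qed.

Let p_gt0 s : 0 <= s <= b -> 0 < p s.
Proof. by move=> /q_gt0; rewrite invr_gt0. Qed.

Let is_derive_q (s : R) : is_derive s 1 q (- t).
Proof.
have := is_deriveB (is_derive_cst (1 : R) s 1) (is_deriveZ t (is_derive_id s 1)).
by rewrite sub0r [t *: _]mulr1.
Qed.

Let is_derive_p s : 0 <= s <= b -> is_derive s 1 p (t * p s ^+ 2).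
Proof.
move=> /q_gt0 qs.
apply: is_derive_eq; first exact: (is_deriveV (lt0r_neq0 qs) (is_derive_q s)).
by rewrite -exprVn /p [_ *: _]mulrNN mulrC.
Qed.

(** Where m > 0, the hypothesis says that m^(-1/2) decreases at rate at most 1; it starts from 1 /
    t. Both [m] and [t] may vanish, so [m + d ^+ 2] is treated first and [d] then tends to 0. *)
Lemma sqrt_growth (m dm : R -> R) :
  (forall s, 0 <= s <= b -> is_derive s 1 m (dm s)) ->
  (forall s, 0 <= s <= b -> 0 <= m s) ->
  (forall s, 0 <= s <= b -> dm s ^+ 2 <= 4 * m s ^+ 3) ->
  m 0 = t ^+ 2 -> m b * (1 - t * b) ^+ 2 <= t ^+ 2.
Proof.
move=> hm m0 dm2 mt.
have bb : 0 <= b <= b by rewrite b0 lexx.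
have zb : 0 <= (0 : R) <= b by rewrite b0 lexx.
have pert d : 0 < d -> Num.sqrt (m b) * (1 - t * b) <=
    t + d * (1 + Num.sqrt (m b) * b).
  (* M is m made positive, so that the decay rate of M^(-1/2), which is at most
     1, can be integrated. *)
  move=> d0; pose M (s : R) := m s + d ^+ 2.
  have d2 : 0 < d ^+ 2 by rewrite exprn_gt0.
  have M0 s : 0 <= s <= b -> 0 < M s by move=> /m0 ms; rewrite ltr_wpDl.
  have hM s : 0 <= s <= b -> is_derive s 1 M (dm s).
    move=> /hm hms; have := is_deriveD hms (is_derive_cst (d ^+ 2) s 1).
    by rewrite addr0.
  pose r s := Num.sqrt (M s).
  have r0 s : 0 <= s <= b -> 0 < r s by move=> /M0; rewrite sqrtr_gt0.
  have r2 s : 0 <= s <= b -> r s ^+ 2 = M s.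
    by move=> /M0/ltW; exact: sqr_sqrtr.
  have hr s : 0 <= s <= b -> is_derive s 1 r ((2 * r s)^-1 * dm s).
    by move=> sb; apply: is_derive1_comp (is_derive1_sqrt (M0 s sb)) (hM s sb).
  pose F (s : R) := - (r s)^-1 - s.
  have hF s : 0 <= s <= b -> is_derive s 1 F (dm s / (2 * r s ^+ 3) - 1).
    move=> sb; apply: is_derive_eq.
      apply: is_deriveB (is_derive_id s 1).
      exact: (is_deriveN (is_deriveV (lt0r_neq0 (r0 s sb)) (hr s sb))).
    congr (_ - _); rewrite scaleNr opprK [_ *: _]mulrC.
    by field; rewrite gt_eqF// r0.
  have : F b <= F 0.
    apply: derive1_le0_le hF _ => // s sb; rewrite subr_le0.
    have rs := r0 s sb.
    rewrite ler_pdivrMr ?mulr_gt0 ?exprn_gt0// mul1r.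
    rewrite (le_trans (ler_norm _))// -(@ler_pXn2r _ 2) ?nnegrE//; last first.
      by rewrite mulr_ge0// exprn_ge0// ltW.
    rewrite real_normK ?num_real// (le_trans (dm2 s sb))//.
    rewrite exprMn -exprM mulnC exprM r2// (_ : 2 ^+ 2 = 4 :> R); last by ring.
    rewrite ler_wpM2l// lerXn2r ?nnegrE ?(ltW (M0 _ sb))// ?m0//.
    by rewrite lerDl ltW.
  rewrite /F subr0 => Fb.
  have rb := r0 b bb; have r0' := r0 0 zb.
  have Eb : r b <= r 0 + b * r 0 * r b.
    have : (r 0)^-1 * (r 0 * r b) <= ((r b)^-1 + b) * (r 0 * r b).
      by rewrite ler_pM2r ?mulr_gt0//; lra.
    rewrite mulKf ?gt_eqF// => /le_trans; apply.
    by rewrite le_eqVlt; apply/orP; left; apply/eqP; field; rewrite gt_eqF.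
  have r0le : r 0 <= t + d.
    rewrite -(@ler_pXn2r _ 2) ?nnegrE ?(ltW r0') ?addr_ge0 ?(ltW d0)// r2//.
    rewrite /M mt sqrrD lerD2r lerDl mulrn_wge0// mulr_ge0//; exact: ltW.
  have yle : Num.sqrt (m b) <= r b by rewrite ler_wsqrtr// lerDl ltW.
  have y0 : 0 <= Num.sqrt (m b) by exact: sqrtr_ge0.
  move: y0 yle; set y := Num.sqrt (m b) => y0 yle.
  (* A rearrangement of the goal. As [d] is arbitrary, the factor may be nonpositive, in which case
     the bound is trivial. *)
  suff : y * (1 - b * (t + d)) <= t + d by lra.
  have [neg|pos] := lerP (1 - b * (t + d)) 0.
    apply: le_trans (_ : 0 <= _); last by rewrite addr_ge0// ltW.
    by rewrite mulr_ge0_le0.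
  apply: le_trans (_ : r b * (1 - b * (t + d)) <= _).
    by rewrite ler_wpM2r// ltW.
  apply: le_trans (_ : r b * (1 - b * r 0) <= _).
    by rewrite ler_wpM2l ?(ltW rb)// lerB// ler_wpM2l.
  by apply: le_trans r0le; lra.
have : Num.sqrt (m b) * (1 - t * b) <= t.
  apply/ler_addgt0Pr => e e0.
  have k0 : 0 < 1 + Num.sqrt (m b) * b.
    by rewrite ltr_pwDl// mulr_ge0// sqrtr_ge0.
  have := pert (e / (1 + Num.sqrt (m b) * b)) (divr_gt0 e0 k0).
  by rewrite divfK ?gt_eqF.
have qb := ltW (q_gt0 b bb).
rewrite -(@ler_pXn2r _ 2) ?nnegrE ?mulr_ge0 ?sqrtr_ge0//.
by rewrite exprMn sqr_sqrtr ?m0.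
Qed.

(** Gronwall's inequality with explicit integrating factors: [m * q ^ 2] is nonincreasing and
    [m * p ^ 2] is nondecreasing. *)
Lemma linear_growth (m dm : R -> R) :
  (forall s, 0 <= s <= b -> is_derive s 1 m (dm s)) ->
  (forall s, 0 <= s <= b -> `|dm s| <= 2 * t / (1 - t * s) * m s) ->
  m b * (1 - t * b) ^+ 2 <= m 0 /\ m 0 * (1 - t * b) ^+ 2 <= m b.
Proof.
move=> hm dmle.
have bb : 0 <= b <= b by rewrite b0 lexx.
have qb := q_gt0 b bb.
split.
  have : (m * (q * q)) b <= (m * (q * q)) 0.
    apply: derive1_le0_le => // s sb.
      exact: (is_deriveM (hm s sb) (is_deriveM (is_derive_q s) (is_derive_q s))).
    have qs := q_gt0 s sb.
    have := le_trans (ler_norm _) (dmle s sb); rewrite -/(q s).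
    rewrite mulrAC ler_pdivlMr// => H.
    rewrite /GRing.scale/= [(q * q) s]/(q s * q s).
    have -> : m s * (q s * - t + q s * - t) + q s * q s * dm s =
      q s * (dm s * q s - 2 * t * m s) by ring.
    by rewrite pmulr_rle0// subr_le0.
  by rewrite /= !fctE /q mulr0 subr0 !mulr1 expr2.
have : (- (m * (p * p))) b <= (- (m * (p * p))) 0.
  apply: derive1_le0_le => // s sb.
    exact: (is_deriveN (is_deriveM (hm s sb)
      (is_deriveM (is_derive_p s sb) (is_derive_p s sb)))).
  have ps := p_gt0 s sb.
  have := dmle s sb; rewrite ler_norml -/(q s) -/(p s) => /andP[H _].
  rewrite /GRing.scale/= [(p * p) s]/(p s * p s) oppr_le0.
  have -> : m s * (p s * (t * p s ^+ 2) + p s * (t * p s ^+ 2)) + p s * p s * dm s =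
    p s ^+ 2 * (dm s + 2 * t * p s * m s) by ring.
  by rewrite mulr_ge0 ?sqr_ge0//; lra.
have p0 : p 0 = 1 by rewrite /p /q mulr0 subr0 invr1.
rewrite /= !fctE lerN2 p0 !mulr1.
move=> H; rewrite -ler_pdivlMr ?exprn_gt0//.
by rewrite expr2 invfM.
Qed.

(** As functions of the endpoint s, the left side has derivative s psi2(s), while the right side, K
    (p - 1)^2, has derivative s times the bound on psi2. Both sides vanish at 0. *)
Lemma taylor_defect (K : R) (psi psi1 psi2 : R -> R) :
  (forall s, 0 <= s <= b -> is_derive s 1 psi (psi1 s)) ->
  (forall s, 0 <= s <= b -> is_derive s 1 psi1 (psi2 s)) ->
  (forall s, 0 <= s <= b -> `|psi2 s| <= 2 * K * t ^+ 2 / (1 - t * s) ^+ 3) ->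
  psi 0 = 0 -> b * psi1 b - psi b <= K * (t * b / (1 - t * b)) ^+ 2.
Proof.
move=> h h1 h2 psi0.
have bb : 0 <= b <= b by rewrite b0 lexx.
have p0 : p 0 = 1 by rewrite /p /q mulr0 subr0 invr1.
pose F := id * psi1 - psi - K \*: ((p - cst 1) * (p - cst 1)).
have dp1 s : 0 <= s <= b -> is_derive s 1 (p - cst 1) (t * p s ^+ 2 - 0).
  by move=> sb; exact: (is_deriveB (is_derive_p s sb) (is_derive_cst (1 : R) s 1)).
have : F b <= F 0.
  apply: derive1_le0_le => // s sb.
    exact: (is_deriveB
      (is_deriveB (is_deriveM (is_derive_id s 1) (h1 s sb)) (h s sb))
      (is_deriveZ K (is_deriveM (dp1 s sb) (dp1 s sb)))).
  have qs := q_gt0 s sb; have ps := p_gt0 s sb.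
  have pE : (p - cst 1) s = t * s * p s.
    by rewrite !fctE -{1}(mulfV (lt0r_neq0 qs)) -/(p s) /q; ring.
  rewrite /GRing.scale/= subr0 mulr1 pE.
  have := le_trans (ler_norm _) (h2 s sb); rewrite -/(q s) -exprVn -/(p s) => H.
  have -> : s * psi2 s + psi1 s - psi1 s -
    K * (t * s * p s * (t * p s ^+ 2) + t * s * p s * (t * p s ^+ 2)) =
    s * (psi2 s - 2 * K * t ^+ 2 * p s ^+ 3) by ring.
  by case/andP: sb => s0 _; rewrite mulr_ge0_le0// subr_le0.
rewrite /F /= !fctE /= psi0 p0 mul0r !subrr mul0r scaler0 !subr0.
have -> : p b - 1 = t * b / (1 - t * b).
  by rewrite -{1}(mulfV (lt0r_neq0 (q_gt0 b bb))) -/(p b) /q; ring.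
by rewrite subr_le0 expr2.
Qed.

End differential_inequalities.

(** * Operator norms and the error of an inexact step *)

Lemma unitmx_ker0 (R : realType) (n : nat) (A : 'M[R]_n) :
  (forall u : 'cV[R]_n, A *m u = 0 -> u = 0) -> A \in unitmx.
Proof.
move=> A0; rewrite -row_full_unit -cokermx_eq0; apply/eqP/matrixP => i j.
have : col j (cokermx A) = 0 by apply: A0; rewrite colE mulmxA mulmx_coker mul0mx.
by move=> /matrixP/(_ i 0); rewrite !mxE.
Qed.

Section operator_norm.
Variables (R : realType) (n : nat) (N : 'cV[R]_n -> R) (c : R).
Hypothesis N_ge0 : forall u, 0 <= N u.
Hypothesis NZ : forall k u, N (k *: u) = `|k| * N u.
Hypothesis ND : forall u v, N (u + v) <= N u + N v.
Hypothesis N_coord : forall (u : 'cV[R]_n) i, `|u i 0| <= c * N u.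

Let N0 : N 0 = 0. Proof. by rewrite -(scale0r 0) NZ normr0 mul0r. Qed.

Let NN u : N (- u) = N u. Proof. by rewrite -scaleN1r NZ normrN1 mul1r. Qed.

Let N_eq0 u : N u = 0 -> u = 0.
Proof.
move=> u0; apply/colP => i; apply/eqP; rewrite mxE -normr_le0.
by rewrite (le_trans (N_coord u i))// u0 mulr0.
Qed.

Let N_sum (I : finType) (F : I -> 'cV[R]_n) : N (\sum_i F i) <= \sum_i N (F i).
Proof.
elim/big_ind2 : _ => [|a x b y ax b_y|//]; first by rewrite N0.
by rewrite (le_trans (ND _ _))// lerD.
Qed.

(** [N_coord] bounds the coordinates on the unit ball. Boundedness is what gives [sup] its meaning:
    on an unbounded set it is a default value. *)
Let opnorm_has_ubound (T : 'M[R]_n) :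
  has_ubound [set N (T *m u) | u in [set u | N u <= 1]].
Proof.
exists (\sum_i `|c| * N (T *m delta_mx i 0)) => _ [v /= v1 <-].
have {1}-> : v = \sum_i v i 0 *: delta_mx i 0.
  by rewrite {1}[v]matrix_sum_delta; apply: eq_bigr => i _; rewrite big_ord1.
rewrite mulmx_sumr (le_trans (N_sum _ _))//; apply: ler_sum => i _.
rewrite -scalemxAr NZ ler_wpM2r// (le_trans (N_coord v i))//.
rewrite (le_trans (ler_norm _))// normrM (ger0_norm (N_ge0 v)).
by rewrite ler_piMr.
Qed.

Let opnorm_ge0 (T : 'M[R]_n) : 0 <= opnorm N T.
Proof.
apply: ub_le_sup; first exact: opnorm_has_ubound.
by exists 0; rewrite /= ?mulmx0 N0.
Qed.

Lemma opnorm_ubound (T : 'M[R]_n) u : N (T *m u) <= opnorm N T * N u.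
Proof.
have [u0|un0] := eqVneq (N u) 0.
  by rewrite (N_eq0 _ u0) mulmx0 N0 mulr0.
have up : 0 < N u by rewrite lt_def un0 N_ge0.
rewrite -ler_pdivrMr//.
have -> : N (T *m u) / N u = N (T *m ((N u)^-1 *: u)).
  by rewrite -scalemxAr NZ normfV (ger0_norm (N_ge0 u)) mulrC.
apply: ub_le_sup; first exact: opnorm_has_ubound.
exists ((N u)^-1 *: u) => //=.
by rewrite NZ normfV (ger0_norm (N_ge0 u)) mulVf.
Qed.

(** One step as linear algebra: [e] is the current error, [G] the Hessian, [gr] the gradient, and
    [delta] bounds the error left by an exact Newton step. *)
Lemma inexact_newton_like_error (B G P : 'M[R]_n) (e S gr r : 'cV[R]_n)
    (omega1 omega2 vartheta theta delta : R) :
  B \in unitmx -> G \in unitmx -> P \in unitmx ->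
  B *m S = - gr + r ->
  0 <= vartheta -> 0 <= theta ->
  opnorm N (invmx B *m G) <= omega1 ->
  opnorm N (invmx B *m G - 1%:M) <= omega2 ->
  N (P *m r) <= theta * N (P *m gr) ->
  theta * cond N (P *m G) <= vartheta ->
  N (e - invmx G *m gr) <= delta ->
  N (e + S) <= omega1 * (1 + vartheta) * delta +
    (omega1 * vartheta + omega2) * N e.
Proof.
move=> Bu Gu Pu BS th0 t0 J1 J2 Pr cnd ed.
set J := invmx B *m G in J1 J2; set w := e - invmx G *m gr in ed.
set z := invmx G *m r.
have PGu : P *m G \in unitmx by rewrite unitmx_mul Pu Gu.
have -> : e + S = - ((J - 1%:M) *m e) + (J *m w + J *m z).
  have -> : S = invmx B *m (- gr + r) by rewrite -BS mulKmx.
  rewrite mulmxBl mul1mx /J /w /z mulmxBr -!mulmxA !mulKVmx// mulmxDr mulmxN.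
  by rewrite opprB -addrA; congr (_ + _); rewrite !addrA addNr add0r.
have gN : N (invmx G *m gr) <= N e + delta.
  have -> : invmx G *m gr = e - w by rewrite /w subKr.
  by rewrite (le_trans (ND _ _))// NN lerD2l.
have om1 u : N (J *m u) <= omega1 * N u.
  by rewrite (le_trans (opnorm_ubound _ _))// ler_wpM2r.
have om2 u : N ((J - 1%:M) *m u) <= omega2 * N u.
  by rewrite (le_trans (opnorm_ubound _ _))// ler_wpM2r.
have zN : N z <= vartheta * (N e + delta).
  apply: le_trans (_ : vartheta * N (invmx G *m gr) <= _); last by rewrite ler_wpM2l.
  set y := invmx G *m gr.
  (* Passing through [P *m G] on both sides of the residual bound produces the two operator norms of
     [cond]. *)
  have -> : z = invmx (P *m G) *m (P *m r).
    by rewrite -{1}(mulKmx PGu z) /z -mulmxA mulKVmx.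
  have Pgr : P *m gr = P *m G *m y by rewrite -mulmxA mulKVmx.
  apply: le_trans (opnorm_ubound _ _) _.
  apply: le_trans (ler_wpM2l (opnorm_ge0 _) Pr) _.
  rewrite Pgr mulrCA; apply: le_trans (_ : theta *
    (opnorm N (invmx (P *m G)) * (opnorm N (P *m G) * N y)) <= _).
    by rewrite !ler_wpM2l// opnorm_ubound.
  by rewrite (mulrA _ _ (N y)) mulrA ler_wpM2r// (mulrC (opnorm N (invmx _))).
have om1_ge0 : 0 <= omega1 := le_trans (opnorm_ge0 _) J1.
rewrite (le_trans (ND _ _))// NN.
rewrite (le_trans (lerD (om2 _) (ND _ _)))//.
rewrite (le_trans (lerD (lexx _) (lerD (om1 w) (om1 z))))//.
have := lerD (ler_wpM2l om1_ge0 ed) (ler_wpM2l om1_ge0 zN); lra.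
Qed.

End operator_norm.

(** * The local norm *)

Section local_norm_theory.
Variables (R : realType) (n : nat) (Omega : set 'cV[R]_n) (alpha : R).
Variables (g : 'cV[R]_n -> R) (xs : 'cV[R]_n).
Hypotheses (oO : open Omega) (sc : self_concordant Omega alpha g).
Hypotheses (Oxs : Omega xs) (Hu : hess g xs \in unitmx).
Let N := local_norm alpha g xs.
Let Q (u v : 'cV[R]_n) := inner (hess g xs *m u) v.

Let a0 : 0 < alpha. Proof. by have [] := sc. Qed.
Let g3 : Ck_on Omega 3 g. Proof. by have [] := sc. Qed.
Let g2 : Ck_on Omega 2 g. Proof. exact: Ck_on_pred. Qed.

Let hessE x u v : Omega x -> inner (hess g x *m u) v = 'D_v ('D_u g) x.
Proof. by move=> Ox; apply: (inner_hessE R n Omega). Qed.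

Let Q_ge0 u : 0 <= Q u u.
Proof. by rewrite /Q hessE//; exact: (sc_D2_ge0 R n Omega alpha). Qed.

Let Q_lin k u v w : Q (k *: u + v) w = k * Q u w + Q v w.
Proof. exact: hess_linear. Qed.

Let Q_sym u v : Q u v = Q v u.
Proof. exact: (hess_sym R n Omega). Qed.

Let Q_CS u v : Q u v ^+ 2 <= Q u u * Q v v.
Proof. exact: (cauchy_schwarz_form R _ Q). Qed.

Lemma local_norm_ge0 u : 0 <= N u.
Proof. exact: sqrtr_ge0. Qed.

Lemma local_norm_sqr u : N u ^+ 2 = alpha^-1 * D2 g xs u.
Proof.
rewrite /N /local_norm sqr_sqrtr; first by rewrite hessE.
by apply: mulr_ge0; [rewrite invr_ge0 ltW | exact: Q_ge0].
Qed.

Let NQ u : N u ^+ 2 = alpha^-1 * Q u u.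
Proof. by rewrite local_norm_sqr /Q hessE. Qed.

Lemma local_normZ k u : N (k *: u) = `|k| * N u.
Proof.
have Q0 w : Q 0 w = 0 by have := Q_lin (-1) w w w; rewrite scaleN1r addNr; lra.
have Qz c a w : Q (c *: a) w = c * Q a w.
  by rewrite -[c *: a]addr0 Q_lin Q0 addr0.
rewrite /N /local_norm -!/(Q _ _) Qz Q_sym Qz mulrA -expr2 mulrCA.
by rewrite sqrtrM ?sqr_ge0// sqrtr_sqr.
Qed.

Lemma local_normD u v : N (u + v) <= N u + N v.
Proof.
have nu := local_norm_ge0 u; have nv := local_norm_ge0 v.
rewrite -(@ler_pXn2r _ 2) ?nnegrE ?addr_ge0 ?local_norm_ge0//.
rewrite sqrrD !NQ.
have -> : Q (u + v) (u + v) = Q u u + 2 * Q u v + Q v v.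
  rewrite -[in Q (u + v)](scale1r u) Q_lin mul1r (Q_sym u) (Q_sym v).
  by rewrite -[in Q (u + v)](scale1r u) !Q_lin !mul1r (Q_sym v u); ring.
have : alpha^-1 * Q u v <= N u * N v.
  apply: le_trans (ler_norm _) _.
  rewrite -(@ler_pXn2r _ 2) ?nnegrE ?mulr_ge0//.
  rewrite real_normK ?num_real// !exprMn !NQ [leRHS]mulrACA -[_^-1 * _^-1]expr2.
  by rewrite ler_wpM2l ?sqr_ge0.
by rewrite mulr2n; lra.
Qed.

(** The i-th coordinate is the Hessian form paired with the inverse image of the i-th basis vector,
    so Cauchy-Schwarz applies; the sum over i makes the constant uniform. *)
Lemma local_norm_coord : exists c, forall (u : 'cV[R]_n) i, `|u i 0| <= c * N u.
Proof.
pose h i := invmx (hess g xs) *m (delta_mx i 0 : 'cV[R]_n).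
exists (alpha * \sum_i N (h i)) => u i.
have -> : u i 0 = Q (h i) u.
  rewrite /Q /h mulKVmx// /inner (bigD1 i)//= big1 => [|j ji].
    by rewrite mxE !eqxx mul1r addr0.
  by rewrite mxE (negbTE ji) mul0r.
apply: (@le_trans _ _ (alpha * N (h i) * N u)).
  rewrite -(@ler_pXn2r _ 2) ?nnegrE ?mulr_ge0 ?local_norm_ge0 ?(ltW a0)//.
  rewrite real_normK ?num_real// !exprMn !NQ (le_trans (Q_CS _ _))//.
  by rewrite le_eqVlt; apply/orP; left; apply/eqP; field; rewrite gt_eqF.
rewrite ler_wpM2r ?local_norm_ge0// ler_wpM2l ?(ltW a0)//.
by rewrite (bigD1 i)//= lerDl sumr_ge0// => j _; exact: local_norm_ge0.
Qed.

(** * Comparison of derivatives along the segment from [xs] to [xs + e] *)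

Section segment.
Variable e : 'cV[R]_n.
Hypothesis seg : forall s : R, 0 <= s <= 1 -> Omega (xs + s *: e).
Hypothesis e1 : N e < 1.
Let t := N e.
(** The squared length of [h] in the local norm of the moving point. *)
Let q h (s : R) := alpha^-1 * D2 g (xs + s *: e) h.

Let t0 : 0 <= t. Proof. exact: local_norm_ge0. Qed.
Let ai0 : 0 <= alpha^-1. Proof. by rewrite invr_ge0 ltW. Qed.
Let q_ge0 h (s : R) : 0 <= s <= 1 -> 0 <= q h s.
Proof.
by move=> /seg Os; rewrite mulr_ge0//; exact: (sc_D2_ge0 R n Omega alpha).
Qed.
Let q0 h : q h 0 = N h ^+ 2.
Proof. by rewrite /q scale0r addr0 local_norm_sqr. Qed.

Let dq h (s : R) : 0 <= s <= 1 ->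
  is_derive s 1 (q h) (alpha^-1 * 'D_e ('D_h ('D_h g)) (xs + s *: e)).
Proof.
move=> /seg Os.
have der : derivable ('D_h ('D_h g)) (xs + s *: e) e.
  apply: diff_derivable; have [_ +] := g3 => /(_ h)[_ /(_ h)[+ _]]; exact.
exact: (is_deriveZ alpha^-1 (is_derive_line _ _ _ _ _ _ der)).
Qed.

(** Dividing by [alpha] normalises the self-concordance parameter to 1. *)
Let mixed u v (s : R) : 0 <= s <= 1 ->
  (alpha^-1 * 'D_u ('D_u ('D_v g)) (xs + s *: e)) ^+ 2 <= 4 * q u s ^+ 2 * q v s.
Proof.
move=> /seg Os.
have scaled (A X Y : R) : A ^+ 2 <= 4 / alpha * (X ^+ 2 * Y) ->
    (alpha^-1 * A) ^+ 2 <= 4 * (alpha^-1 * X) ^+ 2 * (alpha^-1 * Y).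
  rewrite exprMn => /(ler_wpM2l (sqr_ge0 alpha^-1)) /le_trans; apply.
  by rewrite le_eqVlt; apply/orP; left; apply/eqP; field; rewrite gt_eqF.
exact/scaled/(sc_mixed R n Omega alpha g oO sc).
Qed.

Let ts1 (s : R) : s <= 1 -> t * s < 1.
Proof. by move=> s1; apply: le_lt_trans e1; rewrite ler_piMr. Qed.

(** In its own direction the length obeys the closed inequality |q'| <= 2 q^(3/2), to which
    [sqrt_growth] applies. *)
Let q_e (s : R) : 0 <= s <= 1 -> q e s * (1 - t * s) ^+ 2 <= t ^+ 2.
Proof.
move=> /andP[s0 s1].
have sub r : 0 <= r <= s -> 0 <= r <= 1.
  by move=> /andP[-> rs]; exact: le_trans rs s1.
apply: (sqrt_growth R t s t0 s0 (ts1 s s1) (q e)) => [r rs|r rs|r rs|].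
- exact: dq (sub r rs).
- exact: q_ge0 (sub r rs).
- by apply: le_trans (mixed e e r (sub r rs)) _; rewrite -mulrA -exprSr.
- by rewrite q0.
Qed.

(** The mixed bound gives |q_h'| <= 2 sqrt(q_e) q_h, and [q_e] bounds the coefficient by 2 t / (1 -
    t s), as [linear_growth] requires. *)
Let q_h h (s : R) : 0 <= s <= 1 -> q h s * (1 - t * s) ^+ 2 <= q h 0 /\
  q h 0 * (1 - t * s) ^+ 2 <= q h s.
Proof.
move=> /andP[s0 s1].
have sub r : 0 <= r <= s -> 0 <= r <= 1.
  by move=> /andP[-> rs]; exact: le_trans rs s1.
apply: (linear_growth R t s t0 s0 (ts1 s s1) (q h)) => [r rs|r rs].
  exact: dq (sub r rs).
have rs' := sub r rs; have Or := seg r rs'.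
have p0 : 0 < 1 - t * r by rewrite subr_gt0 ts1//; case/andP: rs'.
have qh := q_ge0 h r rs'.
have rhs0 : 0 <= 2 * t / (1 - t * r) * q h r.
  by apply: mulr_ge0 => //; rewrite divr_ge0 ?mulr_ge0 ?(ltW p0).
rewrite -(@ler_pXn2r _ 2) ?nnegrE//.
rewrite real_normK ?num_real//.
(* The repeated direction [h] is moved to the two outer places, where [mixed] expects it. *)
rewrite (D3_swap12 R n Omega g oO _ g3 Or) (D3_swap23 R n Omega g oO _ g3 Or).
apply: le_trans (mixed h e r rs') _.
have -> : (2 * t / (1 - t * r) * q h r) ^+ 2 =
  4 * q h r ^+ 2 * (t ^+ 2 / (1 - t * r) ^+ 2).
  by field; rewrite gt_eqF.
apply: ler_wpM2l; first by rewrite mulr_ge0 ?sqr_ge0.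
by rewrite ler_pdivlMr ?exprn_gt0// q_e.
Qed.

Lemma local_norm_le_D2 h : N h ^+ 2 * (1 - t) ^+ 2 <= alpha^-1 * D2 g (xs + e) h.
Proof.
have [_] := q_h h 1 ltac:(by rewrite ler01 lexx).
by rewrite q0 mulr1 /q scale1r.
Qed.

(** The factor (1 - t)^2 is positive, so a kernel vector has local norm 0 at [xs] and hence zero
    coordinates. *)
Lemma hess_segment_unit : hess g (xs + e) \in unitmx.
Proof.
apply: unitmx_ker0 => u Hu0; have [c N_coord] := local_norm_coord.
apply/colP => i; apply/eqP; rewrite mxE -normr_le0.
have := local_norm_le_D2 u.
have Oe : Omega (xs + e) by rewrite -[e]scale1r; apply: seg; rewrite ler01 lexx.
have -> : D2 g (xs + e) u = 0.
  rewrite /D2 -hessE// Hu0 /inner big1// => j _; by rewrite mxE mul0r.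
rewrite mulr0 pmulr_lle0 ?exprn_gt0 ?subr_gt0// => N2.
have N0 : N u = 0 by apply/eqP; rewrite -sqrf_eq0 eq_le N2 sqr_ge0.
by have := N_coord u i; rewrite N0 mulr0.
Qed.

(** [taylor_defect] for ['D_h g] along the segment, with K = alpha N(h). In the mixed bound the two
    directions [e] are controlled by [q_e] and [h] by [q_h], which yields the power (1 - t s)^3. *)
Lemma grad_taylor h : grad g xs = 0 ->
  inner (hess g (xs + e) *m e - grad g (xs + e)) h <=
  alpha * N h * (t / (1 - t)) ^+ 2.
Proof.
move=> gr0.
have I1 : 0 <= (1 : R) <= 1 by rewrite ler01 lexx.
have Oe : Omega (xs + e) by rewrite -[e]scale1r; apply: seg.
have dg x : Omega x -> differentiable g x by have [+ _] := g3; apply.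
have ddg u x : Omega x -> differentiable ('D_u g) x.
  by have [_ /(_ u)[+ _]] := g3; apply.
have -> : inner (hess g (xs + e) *m e - grad g (xs + e)) h =
    'D_e ('D_h g) (xs + e) - 'D_h g (xs + e).
  rewrite -(inner_gradE R n g (xs + e) h (dg _ Oe)) -(hessE (xs + e) h e Oe).
  rewrite (hess_sym R n Omega g oO _ g2 Oe) /inner -sumrB.
  by apply: eq_bigr => i _; rewrite !mxE mulrBl.
have := taylor_defect R t 1 t0 ler01 (ts1 1 (lexx _)) (alpha * N h)
  (fun s : R => 'D_h g (xs + s *: e)) (fun s : R => 'D_e ('D_h g) (xs + s *: e))
  (fun s : R => 'D_e ('D_e ('D_h g)) (xs + s *: e)).
rewrite scale1r mul1r !mulr1; apply.
- by move=> s /seg Os; apply: is_derive_line; apply: diff_derivable; exact: ddg.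
- move=> s /seg Os; apply: is_derive_line; apply: diff_derivable.
  by have [_ /(_ h)[_ /(_ e)[+ _]]] := g3; apply.
- move=> s sI; have Os := seg s sI.
  have p0 : 0 < 1 - t * s by rewrite subr_gt0 ts1//; case/andP: sI.
  have Nh := local_norm_ge0 h.
  rewrite -(@ler_pXn2r _ 2) ?nnegrE//; last first.
    by rewrite divr_ge0 ?mulr_ge0 ?exprn_ge0 ?(ltW p0) ?(ltW a0).
  rewrite real_normK ?num_real//.
  have M := mixed e h s sI.
  have [Qh _] := q_h h s sI; have Qe := q_e s sI.
  rewrite q0 in Qh; rewrite -ler_pdivlMr ?exprn_gt0// in Qh.
  rewrite -ler_pdivlMr ?exprn_gt0// in Qe.
  have {M} : (alpha^-1 * 'D_e ('D_e ('D_h g)) (xs + s *: e)) ^+ 2 <=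
      4 * (t ^+ 2 / (1 - t * s) ^+ 2) ^+ 2 * (N h ^+ 2 / (1 - t * s) ^+ 2).
    apply: le_trans M _; rewrite -[leLHS]mulrA -[leRHS]mulrA; apply: ler_wpM2l => //.
    apply: ler_pM; [exact: sqr_ge0|exact: q_ge0| |exact: Qh].
    by rewrite lerXn2r ?nnegrE ?q_ge0// divr_ge0 ?sqr_ge0.
  have unscale (A X : R) : (alpha^-1 * A) ^+ 2 <= X -> A ^+ 2 <= alpha ^+ 2 * X.
    by rewrite -ler_pdivrMl ?exprn_gt0// exprMn exprVn.
  move=> /unscale/le_trans; apply.
  by rewrite le_eqVlt; apply/orP; left; apply/eqP; field; rewrite gt_eqF.
- rewrite scale0r addr0 -(inner_gradE R n g xs h (dg _ Oxs)) gr0 /inner.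
  by rewrite big1// => i _; rewrite mxE mul0r.
Qed.

(** [grad_taylor] is tested on the Newton error [d] itself; the lower bound on the Hessian then
    cancels one factor N(d) and leaves t^2 / (1 - t)^4. *)
Lemma newton_error : grad g xs = 0 -> 0 < 2 * (1 - t) ^+ 2 - 1 ->
  N (e - invmx (hess g (xs + e)) *m grad g (xs + e)) <=
  t ^+ 2 / (2 * (1 - t) ^+ 2 - 1).
Proof.
move=> gr0 D0; set d := e - _.
have Gu := hess_segment_unit.
have Oe : Omega (xs + e).
  by rewrite -[e]scale1r; apply: seg; rewrite ler01 lexx.
have p0 : 0 < 1 - t by rewrite subr_gt0.
have dE : hess g (xs + e) *m e - grad g (xs + e) = hess g (xs + e) *m d.
  by rewrite mulmxBr mulKVmx.
have := grad_taylor d gr0; rewrite dE hessE// => up.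
have lo := local_norm_le_D2 d.
have {}lo : alpha * (N d ^+ 2 * (1 - t) ^+ 2) <= D2 g (xs + e) d.
  by rewrite -ler_pdivlMl.
have := le_trans lo up; rewrite -mulrA ler_pM2l// => H.
have [N0|Nn0] := eqVneq (N d) 0; first by rewrite N0 divr_ge0 ?sqr_ge0// ltW.
have Np : 0 < N d by rewrite lt_def Nn0 local_norm_ge0.
move: H; rewrite expr2 -mulrA ler_pM2l// expr_div_n -ler_pdivlMr ?exprn_gt0// => H.
apply: le_trans H _.
rewrite -mulrA ler_wpM2l ?sqr_ge0// -invfM lef_pV2 ?posrE ?mulr_gt0 ?exprn_gt0//.
(* (1 - t)^4 >= 2 (1 - t)^2 - 1 is the nonnegativity of this square. *)
by have := sqr_ge0 ((1 - t) ^+ 2 - 1); lra.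
Qed.

End segment.

End local_norm_theory.

(** * Convergence *)

(** The square root is at least [a], whence t < 1. Squaring a + 4 b - 4 b t > sqrt D gives the
    second inequality multiplied by 8 b. *)
Lemma lt_smaller_root (R : realType) (a b t : R) : 0 < a -> 0 < b ->
  t < (a + 4 * b - Num.sqrt ((a + 4 * b) ^+ 2 - 8 * b ^+ 2)) / (4 * b) ->
  t < 1 /\ a * t < b * (2 * (1 - t) ^+ 2 - 1).
Proof.
move=> a0 b0; set D := _ - 8 * _; set s := Num.sqrt D.
have b40 : 0 < 4 * b by rewrite mulr_gt0.
have DE : D = a ^+ 2 + 8 * b * (a + b) by rewrite /D; ring.
have aD : a ^+ 2 <= D by rewrite DE lerDl ?mulr_ge0 ?addr_ge0 ?ltW.
have D0 : 0 <= D by apply: le_trans aD; exact: sqr_ge0.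
have s0 : 0 <= s by exact: sqrtr_ge0.
have as_ : a <= s by rewrite -(ger0_norm (ltW a0)) -sqrtr_sqr ler_wsqrtr.
rewrite ltr_pdivlMr// => ts; split.
  by rewrite -(ltr_pM2r b40) mul1r; lra.
have : D < (a + 4 * b - 4 * b * t) ^+ 2.
  by rewrite -(sqr_sqrtr D0) ltr_pXn2r ?nnegrE// -/s; lra.
rewrite /D -subr_gt0.
have -> : (a + 4 * b - 4 * b * t) ^+ 2 - ((a + 4 * b) ^+ 2 - 8 * b ^+ 2) =
  8 * b * (b * (2 * (1 - t) ^+ 2 - 1) - a * t) by ring.
by rewrite pmulr_rgt0 ?mulr_gt0// subr_gt0.
Qed.

Lemma W_kappa_sub (R : realType) (n : nat) (N : 'cV[R]_n -> R)
    (Omega : set 'cV[R]_n) (xs : 'cV[R]_n) :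
  W N xs (kappa N Omega xs) `<=` Omega.
Proof.
move=> x; rewrite /W /kappa /= => /ereal_sup_gt[_ [u [u0 Wu] <-]] xu.
exact: Wu.
Qed.

Lemma convex_set_segment (R : realType) (n : nat) (Omega : set 'cV[R]_n) x y :
  @convex_set R 'cV[R]_n Omega -> Omega x -> Omega y ->
  forall s : R, 0 <= s <= 1 -> Omega (x + s *: (y - x)).
Proof.
move=> cO Ox Oy s /andP[s0 s1].
have := cO _ _ (Itv01 s0 s1) (mem_set Oy) (mem_set Ox) => /set_mem.
have -> : x + s *: (y - x) = s *: y + (1 - s) *: x.
  by rewrite scalerBr scalerBl scale1r addrCA.
exact.
Qed.

(** Convergence of vectors is measured by the largest entry, so a geometric bound uniform in the
    coordinates suffices. *)
Lemma cvg_geometric_bound (R : realType) (n : nat) (x : nat -> 'cV[R]_n)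
    (xs : 'cV[R]_n) (C beta : R) :
  0 <= beta < 1 -> (forall k i, `|(x k - xs) i 0| <= C * beta ^+ k) ->
  x @ \oo --> xs.
Proof.
move=> /andP[b0 b1] xC.
have gC : (fun k => C * beta ^+ k) @ \oo --> 0.
  by apply: cvg_geometric; rewrite ger0_norm.
apply/cvgrPdist_le => e e0; near=> k.
have Ck : C * beta ^+ k <= e by near: k; exact: cvgr_le gC _ e0.
rewrite distrC -[`|_|]/(mx_norm _) mx_normrE; apply: bigmax_le; first exact: ltW.
by move=> [i j] _; rewrite /= ord1 (le_trans (xC k i)).
Unshelve. all: by end_near. Qed.

Theorem theorem18 (R : realType) (n : nat) (Omega : set 'cV[R]_n)
    (g : 'cV[R]_n -> R) (alpha : R) (xs : 'cV[R]_n)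
    (vartheta omega1 omega2 : R)
    (B : 'cV[R]_n -> 'M[R]_n) (P : nat -> 'M[R]_n) (theta : nat -> R)
    (x S r : nat -> 'cV[R]_n) :
  open Omega ->
  @convex_set R 'cV[R]_n Omega ->
  self_concordant Omega alpha g ->
  Omega xs ->
  hess g xs \in unitmx ->
  grad g xs = 0 ->
  0 <= vartheta < 1 ->
  0 <= omega2 < omega1 ->
  omega1 * vartheta + omega2 < 1 ->
  let N := local_norm alpha g xs in
  let a := omega1 * (1 + vartheta) in
  let b := 1 - omega1 * vartheta - omega2 in
  let sigma := Order.min (kappa N Omega xs)
    ((a + 4 * b - Num.sqrt ((a + 4 * b) ^+ 2 - 8 * b ^+ 2)) / (4 * b))%:E in
  let step := inexact_newton_like_step g N omega1 omega2 vartheta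
    B P theta x S r in
  W N xs sigma (x 0%N) ->
  x 0%N <> xs ->
  (* well defined: however the first k steps have been carried out, the
     conditions defining step k make sense *)
  (forall k : nat, (forall j : nat, (j < k)%N -> step j) ->
     Omega (x k) /\ hess g (x k) \in unitmx) /\
  ((forall k : nat, step k) ->
   [/\ forall k : nat, W N xs sigma (x k),
       x @ \oo --> xs &
       forall k : nat,
         N (x k.+1 - xs) <=
         (omega1 * (1 + vartheta) *
            (N (x 0%N - xs) / (2 * (1 - N (x 0%N - xs)) ^+ 2 - 1)) +
          omega1 * vartheta + omega2) * N (x k - xs)]).
Proof.
move=> oO cO sc Oxs Hu gr0 /andP[th0 th1] /andP[om2 om21] om_lt1 N a b sigma step.
have om1 : 0 < omega1 := le_lt_trans om2 om21.
have a0 : 0 < a by rewrite mulr_gt0// ltr_wpDr.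
have b0 : 0 < b by rewrite /b -addrA -opprD subr_gt0.
have N_ge0 : forall u, 0 <= N u by exact: local_norm_ge0.
have [c N_coord] := local_norm_coord R n Omega alpha g xs oO sc Oxs Hu.
move=> Wx0 _; set t0 := N (x 0%N - xs); set D0 := 2 * (1 - t0) ^+ 2 - 1.
(* The contraction factor of the first step; it is below 1 because a t0 < b D0. *)
set beta := a * (t0 / D0) + omega1 * vartheta + omega2.
have W_le y z : W N xs sigma y -> N (z - xs) <= N (y - xs) -> W N xs sigma z.
  by rewrite /W /= => + zy; apply: le_lt_trans; rewrite lee_fin.
(* The two terms of the minimum act separately: [kappa] keeps [y] in [Omega], and the root makes the
   step contract. *)
have W_sub y : W N xs sigma y ->
    [/\ Omega y, N (y - xs) < 1 &
      a * N (y - xs) < b * (2 * (1 - N (y - xs)) ^+ 2 - 1)].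
  rewrite /W /= lt_min lte_fin => /andP[/(W_kappa_sub R n) Oy].
  by move=> /(lt_smaller_root R _ _ _ a0 b0)[? ?]; split.
have W_unit y : W N xs sigma y -> hess g y \in unitmx.
  move=> /W_sub[Oy y1 _]; rewrite -(subrKC xs y).
  apply: (hess_segment_unit R n Omega alpha) => //.
  exact: convex_set_segment.
have [_ t01 at0] := W_sub _ Wx0.
have D0_gt0 : 0 < D0.
  by rewrite -(pmulr_rgt0 _ b0); apply: le_lt_trans at0; rewrite mulr_ge0// ltW.
have beta0 : 0 <= beta.
  rewrite !addr_ge0// mulr_ge0 ?(ltW a0) ?(ltW om1)//.
  by rewrite divr_ge0 ?N_ge0// ltW.
have beta1 : beta < 1.
  have : a * (t0 / D0) < b by rewrite mulrA ltr_pdivrMr.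
  by rewrite /beta /b; lra.
have step_le k : W N xs sigma (x k) -> N (x k - xs) <= t0 -> step k ->
    N (x k.+1 - xs) <= beta * N (x k - xs).
  move=> Wk tk [xk BS Bu J1 J2 thk Pu Pr cnd].
  have [Ok k1 _] := W_sub _ Wk; have Gu := W_unit _ Wk.
  set t := N (x k - xs) in tk k1 *; set D := 2 * (1 - t) ^+ 2 - 1.
  have D0D : D0 <= D.
    rewrite lerD2r ler_pM2l// lerXn2r ?nnegrE ?subr_ge0 ?(ltW k1) ?(ltW t01)//.
    by rewrite lerB.
  have D_gt0 : 0 < D := lt_le_trans D0_gt0 D0D.
  (* From t <= t0 and D0 <= D follows t^2 / D <= (t0 / D0) t, so the factor of the first step serves
     for all steps. *)
  have err : N (x k - xs - invmx (hess g (x k)) *m grad g (x k)) <= t0 / D0 * t.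
    have := newton_error R n Omega alpha g xs oO sc Oxs Hu (x k - xs)
      (convex_set_segment R n Omega xs (x k) cO Oxs Ok) k1 gr0 D_gt0.
    rewrite subrKC => /le_trans; apply; rewrite expr2 mulrAC ler_wpM2r ?N_ge0//.
    by apply: ler_pM; rewrite ?N_ge0 ?invr_ge0 ?(ltW D_gt0)// lef_pV2 ?posrE.
  rewrite xk addrAC.
  apply: le_trans (inexact_newton_like_error R n N c N_ge0 _ _ N_coord
    _ _ _ _ _ _ _ _ _ _ _ _ Bu Gu Pu BS th0 thk J1 J2 Pr cnd err) _.
  - by move=> *; apply: (local_normZ R n Omega).
  - by move=> *; apply: (local_normD R n Omega).
  - by rewrite /beta /a -/t; lra.
(* Only the steps before [k] are assumed, so that the bound also yields well-definedness. *)
have main k : (forall j, (j < k)%N -> step j) -> N (x k - xs) <= t0 * beta ^+ k.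
  elim: k => [_|k ih stepk]; first by rewrite expr0 mulr1.
  have {}ih : N (x k - xs) <= t0 * beta ^+ k.
    by apply: ih => j jk; apply: stepk; exact: ltnW.
  have tk : N (x k - xs) <= t0.
    by rewrite (le_trans ih)// ler_piMr ?N_ge0// exprn_ile1// ltW.
  apply: le_trans (step_le k (W_le _ _ Wx0 tk) tk (stepk k (ltnSn k))) _.
  by rewrite exprS mulrCA ler_wpM2l.
have Wk k : (forall j, (j < k)%N -> step j) -> W N xs sigma (x k).
  move=> /main xk; apply: (W_le _ _ Wx0); rewrite (le_trans xk)//.
  by rewrite ler_piMr ?N_ge0// exprn_ile1// ltW.
split=> [k /Wk Wxk|steps]; first by split; [have [] := W_sub _ Wxk|exact: W_unit].
split=> [k||k].
- by apply: Wk => j _; exact: steps.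
(* The absolute value is taken because [local_norm_coord] does not give the sign of [c]. *)
- apply: (cvg_geometric_bound R n x xs (`|c| * t0) beta).
    by rewrite beta0 beta1.
  move=> k i; apply: le_trans (N_coord _ _) _; rewrite -mulrA.
  apply: le_trans (ler_wpM2r (N_ge0 _) (ler_norm c)) _.
  by rewrite ler_wpM2l//; apply: main => j _; exact: steps.
- rewrite -/t0 -/D0 -/a -/beta; apply: step_le => //.
    by apply: Wk => j _; exact: steps.
  apply: le_trans (main k (fun j _ => steps j)) _.
  by rewrite ler_piMr ?N_ge0// exprn_ile1// ltW.
Qed.
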